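(* Let $S:\mathbb{R}^n\rightrightarrows\mathbb{R}^m$ be locally closed at $(\bar x,\bar y)\in\mathrm{gph}(S)$, and let $H:\mathbb{R}^n\rightrightarrows\mathbb{R}^m$ be a prefan. Then $S$ is pseudo strictly $H$-differentiable at $(\bar x,\bar y)$ if and only if $$G(p)\cap[-H(-p)]\neq\emptyset\quad\text{whenever }p\in\mathbb{R}^n\setminus\{0\}\text{ and }\mathrm{gph}(G)\in\operatorname*{LIMSUP}_{(x,y)\to(\bar x,\bar y),\ (x,y)\in\mathrm{gph}(S)}T_{\mathrm{gph}(S)}(x,y).$$ The equivalence continues to hold if $T_{\mathrm{gph}(S)}(x,y)$ in this condition is replaced by its closed convex hull $\mathrm{cl}\,\mathrm{co}\,T_{\mathrm{gph}(S)}(x,y)$.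
   Context: A set-valued map $S:\mathbb{R}^n\rightrightarrows\mathbb{R}^m$ assigns to each $x$ a subset $S(x)\subset\mathbb{R}^m$ (possibly empty); its graph is $\mathrm{gph}(S)=\{(x,y)\mid y\in S(x)\}$. $S$ is locally closed at $(\bar x,\bar y)\in\mathrm{gph}(S)$ if $\mathrm{gph}(S)\cap\mathbb{B}_\epsilon((\bar x,\bar y))$ is closed for some $\epsilon>0$, where $\mathbb{B}_\epsilon(z)$ is the closed ball of radius $\epsilon$ centered at $z$; $\mathbb{B}$ is the closed unit ball. $H:\mathbb{R}^n\rightrightarrows\mathbb{R}^m$ is positively homogeneous if $0\in H(0)$ and $H(kw)=kH(w)$ for all $k>0$, $w\in\mathbb{R}^n$. For a real $\delta>0$, $(H+\delta)(w):=H(w)+\delta\|w\|\mathbb{B}$. $H$ is a prefan if it is positively homogeneous, $H(p)$ is nonempty, convex and compact for all $p$, and $\|H\|^{+}:=\sup_{\|w\|\le1}\sup_{z\in H(w)}\|z\|$ is finite. $S$ is pseudo strictly $H$-differentiable at $(\bar x,\bar y)\in\mathrm{gph}(S)$ if for any $\delta>0$ there are neighborhoods $U_\delta$ of $\bar x$ and $V_\delta$ of $\bar y$ such that $S(x)\cap V_\delta\subset S(x')+(H+\delta)(x-x')$ for all $x,x'\in U_\delta$. For a set $C$ and $\bar z\in C$, the tangent (contingent) cone $T_C(\bar z)$ is the set of $w$ such that $(z_i-\bar z)/\tau_i\to w$ for some $z_i\to\bar z$, $z_i\in C$, $\tau_i\searrow0$. For a set-valued map $R:\mathrm{gph}(S)\rightrightarrows\mathbb{R}^n\times\mathbb{R}^m$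 with nonempty closed values, $\operatorname{LIMSUP}_{(x,y)\to(\bar x,\bar y),\,(x,y)\in\mathrm{gph}(S)}R(x,y)$ is the family of all sets $C\subset\mathbb{R}^n\times\mathbb{R}^m$ for which there is a sequence $(x_j,y_j)\in\mathrm{gph}(S)$ with $(x_j,y_j)\to(\bar x,\bar y)$ and $R(x_j,y_j)\to C$, where set convergence is in the Painlevé–Kuratowski sense (the inner limit and the outer limit of the sequence of sets both equal $C$). A set $C\subset\mathbb{R}^n\times\mathbb{R}^m$ is identified with the graph of the map $G$ given by $G(p)=\{q\mid(p,q)\in C\}$. *)

(* Defs.v *)
From HB Require Import structures.
From mathcomp Require Import all_boot all_order all_algebra.
From mathcomp Require Import all_classical all_reals all_analysis.

Set Implicit Arguments.
Unset Strict Implicit.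
Unset Printing Implicit Defensive.

Import Order.TTheory GRing.Theory Num.Theory.
Import numFieldNormedType.Exports.

Local Open Scope classical_set_scope.
Local Open Scope ring_scope.

(* The library norm on 'rV[R]_n and on products is the sup norm, so the
   Euclidean norms are introduced explicitly. The topologies coincide, and
   the library topology is used throughout. *)
Definition enorm (R : realType) (n : nat) (x : 'rV[R]_n) : R :=
  Num.sqrt (\sum_(i < n) x ord0 i ^+ 2).

Definition enorm2 (R : realType) (n m : nat) (z : 'rV[R]_n * 'rV[R]_m) : R :=
  Num.sqrt (enorm z.1 ^+ 2 + enorm z.2 ^+ 2).

Definition eunit_ball (R : realType) (n : nat) : set 'rV[R]_n :=
  [set x | enorm x <= 1].

Definition eball2 (R : realType) (n m : nat) (z0 : 'rV[R]_n * 'rV[R]_m)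
    (eps : R) : set ('rV[R]_n * 'rV[R]_m) :=
  [set z | enorm2 (z - z0) <= eps].

Definition setadd (R : realType) (E : normedModType R) (A B : set E) : set E :=
  [set z | exists a b, [/\ A a, B b & z = a + b]].

Definition setscale (R : realType) (E : normedModType R) (k : R) (A : set E) :
    set E :=
  [set k *: a | a in A].

Definition setopp (R : realType) (E : normedModType R) (A : set E) : set E :=
  [set - a | a in A].

Definition svmap (R : realType) (n m : nat) := 'rV[R]_n -> set 'rV[R]_m.

Definition gph (R : realType) (n m : nat) (S : svmap R n m) :
    set ('rV[R]_n * 'rV[R]_m) :=
  [set z | S z.1 z.2].

Definition locally_closed_at (R : realType) (n m : nat) (S : svmap R n m)
    (z0 : 'rV[R]_n * 'rV[R]_m) : Prop :=
  exists2 eps : R, 0 < eps & closed (gph S `&` eball2 z0 eps).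

Definition pos_homogeneous (R : realType) (n m : nat) (H : svmap R n m) :
    Prop :=
  H 0 0 /\ forall (k : R) w, 0 < k -> H (k *: w) = setscale k (H w).

Definition outer_norm (R : realType) (n m : nat) (H : svmap R n m) : \bar R :=
  ereal_sup [set ereal_sup [set (enorm z)%:E | z in H w]
            | w in @eunit_ball R n].

Definition prefan (R : realType) (n m : nat) (H : svmap R n m) : Prop :=
  [/\ pos_homogeneous H,
      forall p, [/\ H p !=set0, convex_set (H p) & compact (H p)]
    & outer_norm H \is a fin_num].

Definition svmap_plus (R : realType) (n m : nat) (H : svmap R n m)
    (delta : R) : svmap R n m :=
  fun w => setadd (H w) (setscale (delta * enorm w) (@eunit_ball R m)).

Definition pseudo_strictly_differentiable (R : realType) (n m : nat)
    (S H : svmap R n m) (xbar : 'rV[R]_n) (ybar : 'rV[R]_m) : Prop :=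
  forall delta : R, 0 < delta ->
  exists (U : set 'rV[R]_n) (V : set 'rV[R]_m),
    [/\ nbhs xbar U, nbhs ybar V
      & forall x x', U x -> U x' ->
          S x `&` V `<=` setadd (S x') (svmap_plus H delta (x - x'))].

Definition tangent_cone (R : realType) (E : normedModType R) (C : set E)
    (zbar : E) : set E :=
  [set w | exists (z : nat -> E) (tau : nat -> R),
    [/\ forall i, C (z i), z @ \oo --> zbar,
        (forall i, 0 < tau i) /\ tau @ \oo --> 0
      & (fun i => (tau i)^-1 *: (z i - zbar)) @ \oo --> w]].

Definition convex_hull (R : realType) (E : normedModType R) (A : set E) :
    set E :=
  smallest (@convex_set R E) A.

Definition clco (R : realType) (E : normedModType R) (A : set E) : set E :=
  closure (convex_hull A).

Definition inner_limit (R : realType) (E : normedModType R)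
    (C : nat -> set E) : set E :=
  [set w | exists2 z : nat -> E,
    (\forall j \near \oo, C j (z j)) & z @ \oo --> w].

Definition outer_limit (R : realType) (E : normedModType R)
    (C : nat -> set E) : set E :=
  [set w | exists (phi : nat -> nat) (z : nat -> E),
    [/\ forall i j, (i < j)%N -> (phi i < phi j)%N,
        forall j, C (phi j) (z j)
      & z @ \oo --> w]].

Definition PK_converges (R : realType) (E : normedModType R)
    (C : nat -> set E) (D : set E) : Prop :=
  inner_limit C = D /\ outer_limit C = D.

(* F is only ever evaluated on A, so this is LIMSUP of F : A => E. *)
Definition LIMSUP (R : realType) (E : normedModType R) (A : set E) (zbar : E)
    (F : E -> set E) : set (set E) :=
  [set D | exists z : nat -> E,
    [/\ forall j, A (z j), z @ \oo --> zbar
      & PK_converges (fun j => F (z j)) D]].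

(* Main.v *)
Require Import Defs.
From HB Require Import structures.
From mathcomp Require Import all_boot all_order all_algebra.
From mathcomp Require Import all_classical all_reals all_analysis.
From mathcomp Require Import ring lra.

(** Necessity: moving from [(x, y)] in the direction [p] and dividing by the
    step size, compactness of [(H + delta)(- p)] yields a tangent vector
    [(p, - e)] with [e] in [(H + delta)(- p)], and this survives in the
    limit.

    Sufficiency: by compactness of Painleve-Kuratowski convergence, every
    cone [F z] with [z] near the base point contains, for each unit [u], a
    vector close to [{u} x (- H (- u))], uniformly in [u]. Fix [x], [x'] and
    [y] in [S x], and let [u] be the unit vector from [x] to [x']. The front
    [{x + t u} x (y - t (H + delta)(- u))] starts on the graph; a shortest
    segment from the graph to the front is normal to the graph, hence polar
    to [clco T], and therefore makes an obtuse angle with some admissible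
    velocity of the front. So the squared distance grows by at most [O(h^2)]
    on a time step [h], that is, it stays zero, and at time [|x' - x|] the
    front meets [S x']. *)

Set Implicit Arguments.
Unset Strict Implicit.
Unset Printing Implicit Defensive.

Import Order.TTheory GRing.Theory Num.Theory.
Import numFieldNormedType.Exports.

Local Open Scope classical_set_scope.
Local Open Scope ring_scope.

(** * The Euclidean inner product and norm, compared with the sup norm *)

Section Euclidean.
Context {R : realType} {n : nat}.
Implicit Types (x y z : 'rV[R]_n) (k : R).

Definition dotv x y : R := \sum_(i < n) x ord0 i * y ord0 i.

Lemma dotvC x y : dotv x y = dotv y x.
Proof. by apply: eq_bigr => i _; rewrite mulrC. Qed.

Lemma dotvDr x y z : dotv x (y + z) = dotv x y + dotv x z.
Proof. by rewrite -big_split; apply: eq_bigr => i _; rewrite mxE mulrDr. Qed.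

Lemma dotvZr k x y : dotv x (k *: y) = k * dotv x y.
Proof. by rewrite big_distrr; apply: eq_bigr => i _; rewrite mxE mulrCA. Qed.

Lemma dotvDl x y z : dotv (x + y) z = dotv x z + dotv y z.
Proof. by rewrite dotvC dotvDr !(dotvC z). Qed.

Lemma dotvZl k x y : dotv (k *: x) y = k * dotv x y.
Proof. by rewrite dotvC dotvZr dotvC. Qed.

Lemma dotv0l x : dotv 0 x = 0.
Proof. by rewrite -(scale0r 0) dotvZl mul0r. Qed.

Lemma dotvNr x y : dotv x (- y) = - dotv x y.
Proof. by rewrite -scaleN1r dotvZr mulN1r. Qed.

Lemma dotvNl x y : dotv (- x) y = - dotv x y.
Proof. by rewrite dotvC dotvNr dotvC. Qed.

Definition dotvE := (dotvDr, dotvDl, dotvZr, dotvZl, dotvNr, dotvNl).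

Lemma dotv_ge0 x : 0 <= dotv x x.
Proof. by apply: sumr_ge0 => i _; rewrite -expr2 sqr_ge0. Qed.

Lemma enormE x : enorm x = Num.sqrt (dotv x x).
Proof.
by rewrite /enorm; congr Num.sqrt; apply: eq_bigr => i _; rewrite expr2.
Qed.

Lemma enorm_ge0 x : 0 <= enorm x.
Proof. exact: sqrtr_ge0. Qed.

Lemma enorm_sqr x : enorm x ^+ 2 = dotv x x.
Proof. by rewrite enormE sqr_sqrtr// dotv_ge0. Qed.

Lemma enormZ k x : enorm (k *: x) = `|k| * enorm x.
Proof.
by rewrite !enormE !dotvE mulrA -expr2 sqrtrM ?sqr_ge0// sqrtr_sqr.
Qed.

Lemma enormN x : enorm (- x) = enorm x.
Proof. by rewrite -scaleN1r enormZ normrN1 mul1r. Qed.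

Lemma enorm0 : enorm (0 : 'rV[R]_n) = 0.
Proof. by rewrite -(scale0r 0) enormZ normr0 mul0r. Qed.

Lemma enormB x y : enorm (x - y) = enorm (y - x).
Proof. by rewrite -enormN opprB. Qed.

Lemma normr_le_enorm x : `|x| <= enorm x.
Proof.
rewrite [leLHS]/Num.norm/= mx_normrE; apply/bigmax_leP; split.
  exact: enorm_ge0.
move=> [i j] _ /=; rewrite (ord1 i) -sqrtr_sqr ler_sqrt; last first.
  by apply: sumr_ge0 => l _; exact: sqr_ge0.
by rewrite (bigD1 j)//= lerDl sumr_ge0// => l _; exact: sqr_ge0.
Qed.

Lemma enorm_le_normr x : enorm x <= Num.sqrt n%:R * `|x|.
Proof.
rewrite -[`|x|]ger0_norm// -sqrtr_sqr -sqrtrM// ler_sqrt; last first.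
  by rewrite mulr_ge0.
rewrite (le_trans (y := \sum_(i < n) `|x| ^+ 2))//; last first.
  by rewrite sumr_const card_ord -[leLHS]mulr_natl.
apply: ler_sum => i _; rewrite -[leLHS]real_normK ?num_real// ler_sqr ?nnegrE//.
rewrite [leRHS]/Num.norm/= mx_normrE.
by apply/bigmax_geP; right; exists (ord0, i).
Qed.

Lemma enorm_eq0 x : enorm x = 0 -> x = 0.
Proof.
move=> x0; apply/eqP; rewrite -normr_eq0 eq_le normr_ge0 andbT.
by rewrite (le_trans (normr_le_enorm x))// x0.
Qed.

Lemma enorm_gt0 x : x <> 0 -> 0 < enorm x.
Proof.
by move=> x0; rewrite lt_neqAle enorm_ge0 andbT eq_sym; apply/eqP => /enorm_eq0.
Qed.

Lemma dotv_le x y : dotv x y <= enorm x * enorm y.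
Proof.
have [->|/eqP y0] := eqVneq y 0.
  by rewrite dotvC dotv0l mulr_ge0 ?enorm_ge0.
have [->|/eqP x0] := eqVneq x 0.
  by rewrite dotv0l mulr_ge0 ?enorm_ge0.
(* The square expands to [2 |x| |y| (|x| |y| - <x, y>)], whose first factors are positive here. *)
have := dotv_ge0 (enorm y *: x - enorm x *: y).
rewrite !dotvE (dotvC y x) -!enorm_sqr => h.
have : 0 < enorm x * enorm y by rewrite mulr_gt0 ?enorm_gt0.
nra.
Qed.

Lemma enormD x y : enorm (x + y) <= enorm x + enorm y.
Proof.
rewrite -ler_sqr ?nnegrE ?addr_ge0 ?enorm_ge0// enorm_sqr !dotvE (dotvC y x).
by rewrite -!enorm_sqr; have := dotv_le x y; lra.
Qed.

Lemma enorm_triangle x y z : enorm (x - z) <= enorm (x - y) + enorm (y - z).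
Proof. by rewrite -[x - z](subrKA y) enormD. Qed.

Lemma continuous_dotv (T : topologicalType) (f g : T -> 'rV[R]_n) :
  continuous f -> continuous g -> continuous (fun t => dotv (f t) (g t)).
Proof.
move=> fc gc t.
apply: (@continuous_big R _ +%R 0 predT) => // [|i _ {}t].
  exact: add_continuous.
have coord (h : T -> 'rV[R]_n) : continuous h ->
    {for t, continuous (fun t => h t ord0 i)}.
  move=> hc; apply: (@continuous_comp _ _ _ h (fun M => M ord0 i)).
    exact: hc.
  exact: coord_continuous.
by apply: continuousM; exact: coord.
Qed.

Lemma enorm_continuous : continuous (@enorm R n).
Proof.
rewrite (_ : @enorm R n = Num.sqrt \o (fun x => dotv x x)); last first.
  by apply/funext => x; rewrite enormE.
move=> x; apply: continuous_comp; last exact: sqrt_continuous.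
by apply: continuous_dotv => y.
Qed.

Lemma compact_enorm_le k : compact [set x : 'rV[R]_n | enorm x <= k].
Proof.
apply: bounded_closed_compact.
  exists k; split; first exact: num_real.
  move=> M kM x /= xk; rewrite (le_trans (normr_le_enorm x))//.
  by rewrite (le_trans xk)// ltW.
rewrite (_ : mkset _ = @enorm R n @^-1` [set r | r <= k])//.
by apply: closed_comp => [x _|]; [exact: enorm_continuous | exact: closed_le].
Qed.

End Euclidean.

(** * Cluster points, set limits and tangent cones through epsilon criteria *)

Section Sequences.
Context {R : realType} {E : normedModType R}.
Implicit Types (u : nat -> E) (w : E) (C : nat -> set E).

Lemma cvg_seqP u w : u @ \oo --> w <->
  forall e : R, 0 < e -> exists N, forall i, (N <= i)%N -> `|u i - w| < e.
Proof.
rewrite cvgrPdistC_lt; split=> h e /h; first by move=> [N _ hN]; exists N.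
by move=> [N hN]; exists N.
Qed.

Lemma natSinv_lt (e : R) : 0 < e ->
  exists N, forall i, (N <= i)%N -> i.+1%:R^-1 < e.
Proof.
move=> e0; have [N _ hN] := near_infty_natSinv_lt (PosNum e0).
by exists N.
Qed.

Lemma cvg_natSinv u w : (forall i, `|u i - w| < i.+1%:R^-1) -> u @ \oo --> w.
Proof.
move=> h; apply/cvg_seqP => e /natSinv_lt[N hN]; exists N => i /hN.
exact: lt_trans.
Qed.

Lemma compact_frequently (A : set E) u : compact A -> (forall i, A (u i)) ->
  exists2 w, A w & forall (e : R) N, 0 < e ->
    exists2 i, (N <= i)%N & `|u i - w| < e.
Proof.
move=> cA Au; have [|w [Aw cw]] := cA (u @ \oo) _.
  by exists 0%N => // i _; exact: Au.
exists w => // e N e0.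
have [||_ [[i /= Ni <-] /=]] := cw (u @` [set i | (N <= i)%N]) (ball w e).
- by exists N => // i Ni; exists i.
- exact: nbhsx_ballx.
by rewrite -ball_normE/= distrC => uw; exists i.
Qed.

Lemma increasing_choice (P : nat -> nat -> Prop) :
  (forall i N, exists2 j, (N <= j)%N & P i j) ->
  exists phi : nat -> nat,
    (forall i j, (i < j)%N -> (phi i < phi j)%N) /\ forall i, P i (phi i).
Proof.
move=> h.
have /choice[f hf] (iN : nat * nat) :
    exists j, (iN.2 <= j)%N /\ P iN.1 j.
  by case: iN => i N; have [j] := h i N; exists j.
pose phi := fix F i := if i is k.+1 then f (k.+1, (F k).+1) else f (0, 0)%N.
exists phi; split; last first.
  by case=> [|i]; [have [] := hf (0, 0)%N | have [] := hf (i.+1, (phi i).+1)].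
apply: (@homo_ltn _ phi (fun a b => (a < b)%N)) => [? ? ?|i].
  exact: ltn_trans.
by have [] := hf (i.+1, (phi i).+1).
Qed.

Lemma increasing_ge (phi : nat -> nat) :
  (forall i j, (i < j)%N -> (phi i < phi j)%N) -> forall i, (i <= phi i)%N.
Proof.
move=> h; elim=> // i ih; apply: (leq_ltn_trans ih); exact: h.
Qed.

Lemma outer_limitP C w : outer_limit C w <->
  forall (e : R) N, 0 < e -> exists2 j, (N <= j)%N &
    exists2 z, C j z & `|z - w| < e.
Proof.
split=> [[phi [z [inc Cz /cvg_seqP zw]]] e N /zw[K hK]|h].
  exists (phi (maxn N K)).
    by rewrite (leq_trans _ (increasing_ge inc _))// leq_maxl.
  by exists (z (maxn N K)) => //; apply: hK; exact: leq_maxr.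
have [|phi [inc /choice[z hz]]] := @increasing_choice
  (fun i j => exists z, C j z /\ `|z - w| < i.+1%:R^-1).
  move=> i N; have [|j Nj [z Cz zw]] := h i.+1%:R^-1 N.
    by rewrite invr_gt0 ltr0n.
  by exists j => //; exists z.
exists phi, z; split=> // [j|]; first by have [] := hz j.
by apply: cvg_natSinv => i; have [] := hz i.
Qed.

Lemma inner_limitP C w : inner_limit C w <->
  forall e : R, 0 < e -> exists N, forall j, (N <= j)%N ->
    exists2 z, C j z & `|z - w| < e.
Proof.
split=> [[z [N _ Cz] /cvg_seqP zw] e /zw[K hK]|h].
  exists (maxn N K) => j; rewrite geq_max => /andP[Nj Kj].
  by exists (z j); [exact: Cz | exact: hK].
(* Distances to [C j] need not be attained, so [z j] only comes within [1 / (j + 1)] of the infimum;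
   [0] is a dummy value for empty [C j]. *)
have /choice[z hz] (j : nat) : exists z, C j !=set0 -> C j z /\
    forall z', C j z' -> `|z - w| < `|z' - w| + j.+1%:R^-1.
  have [C0|] := pselect (C j !=set0); last by exists 0.
  have infC : has_inf [set `|z - w| | z in C j].
    split; first by have [z Cz] := C0; exists `|z - w|, z.
    by exists 0 => _ [z _ <-].
  have [|_ [z Cz <-] zw] := inf_adherent _ infC (eps := j.+1%:R^-1).
    by rewrite invr_gt0 ltr0n.
  exists z => _; split=> // z' Cz'; apply: (lt_le_trans zw); rewrite lerD2r.
  by apply: ge_inf; [exact: infC.2 | exists z'].
exists z.
  have [N hN] := h 1 ltr01; exists N => // j /hN[z' Cz' _].
  by have [|] := hz j; first exists z'.
apply/cvg_seqP => e e0; have e2 : 0 < e / 2 by lra.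
have [N hN] := h _ e2; have [K hK] := natSinv_lt e2.
exists (maxn N K) => j; rewrite geq_max => /andP[/hN[z' Cz' z'w] /hK jK].
have [|_ /(_ _ Cz')] := hz j; first by exists z'.
by move=> /lt_trans; apply; rewrite [ltRHS]splitr ltrD.
Qed.

Lemma inner_limit_sub_outer C : inner_limit C `<=` outer_limit C.
Proof.
move=> w /inner_limitP h; apply/outer_limitP => e N /h[K hK].
by exists (maxn N K); [exact: leq_maxl | exact/hK/leq_maxr].
Qed.

Lemma tangent_coneP (A : set E) z w :
  (forall e : R, 0 < e -> exists z' (t : R),
    [/\ A z', 0 < t < e, `|z' - z| < e & `|t^-1 *: (z' - z) - w| < e]) ->
  tangent_cone A z w.
Proof.
move=> h; have {h} : forall i : nat, exists zt : E * R,
    [/\ A zt.1, 0 < zt.2 < i.+1%:R^-1, `|zt.1 - z| < i.+1%:R^-1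
    & `|zt.2^-1 *: (zt.1 - z) - w| < i.+1%:R^-1].
  move=> i; have [|z' [t ?]] := h i.+1%:R^-1; first by rewrite invr_gt0 ltr0n.
  by exists (z', t).
move=> /choice[f hf]; exists (fst \o f), (snd \o f); split=> [i||| ].
- by have [] := hf i.
- by apply: cvg_natSinv => i; have [] := hf i.
- split=> [i|]; first by have [_ /andP[]] := hf i.
  apply/cvgrPdistC_lt => e /natSinv_lt[N hN]; exists N => // i /= /hN.
  have [_ /andP[t0 ti] _ _] := hf i; rewrite subr0 gtr0_norm//.
  exact: lt_trans.
- by apply: cvg_natSinv => i; have [] := hf i.
Qed.

(* Along an ultrafilter finer than [\oo] every member of the countable base is
   decided, so a diagonal subsequence eventually decides each of them. *)
Lemma PK_sequentially_compact (I : countType) (B : I -> set E) C :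
  (forall w (e : R), 0 < e -> exists i, B i w /\
     forall z, B i z -> `|z - w| < e) ->
  (forall i, open (B i)) ->
  exists (phi : nat -> nat) (D : set E),
    (forall i j, (i < j)%N -> (phi i < phi j)%N) /\
    PK_converges (C \o phi) D.
Proof.
move=> base openB.
have [U [UU ooU]] := @ultraFilterLemma nat \oo _.
pose hit i := [set j | C j `&` B i !=set0].
pose decided k := [set j | if @unpickle I k is Some i
  then hit i j <-> U (hit i) else True].
have Udecided k : U (decided k).
  rewrite /decided; case: unpickle => [i|]; last first.
    by apply: (@filterS _ U _ setT) => //; exact: filterT.
  have [Ui|Ui] := in_ultra_setVsetC (hit i) UU.
    by apply: filterS (Ui) => j; split.
  apply: filterS (Ui) => j nj; split=> // Ui'.
  by have [x []] := filter_ex (filterI Ui Ui').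
have Uupto N : U [set j | forall k, (k <= N)%N -> decided k j].
  elim: N => [|N ih].
    by apply: filterS (Udecided 0%N) => j d k; rewrite leqn0 => /eqP ->.
  apply: filterS (filterI ih (Udecided N.+1)) => j [dN d] k.
  by rewrite leq_eqVlt => /predU1P[->//|]; exact: dN.
have [|phi [inc dec]] := @increasing_choice
  (fun N j => forall k, (k <= N)%N -> decided k j).
  move=> i N.
  have UN : U [set j | (N <= j)%N] by apply: ooU; exists N.
  by have [j [? ?]] := filter_ex (filterI UN (Uupto i)); exists j.
exists phi, (inner_limit (C \o phi)); split=> //; split=> //.
apply/seteqP; split; last exact: inner_limit_sub_outer.
move=> w /outer_limitP ow; apply/inner_limitP => e /(base w)[i [Biw Be]].
have hitE j : (pickle i <= j)%N -> hit i (phi j) <-> U (hit i).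
  by move=> /(dec j); rewrite /decided/= pickleK.
have [r r0 Br] : exists2 r : R, 0 < r & forall z, `|z - w| < r -> B i z.
  have /nbhs_ballP[r r0 Br] : nbhs w (B i) by exact: open_nbhs_nbhs.
  by exists r => // z zw; apply: Br; rewrite -ball_normE/= distrC.
(* One hit of [B i] at an index past [pickle i], where [phi] follows the verdict of the ultrafilter,
   reveals that verdict; it then forces a hit at every later index. *)
have [j ij [z Cz zw]] := ow r (pickle i) r0.
have Ui : U (hit i) by apply/(hitE j) => //; exists z; split=> //; exact: Br.
exists (pickle i) => k ik; have [z' [Cz' Bz']] := (hitE k ik).2 Ui.
by exists z' => //; exact: Be.
Qed.

End Sequences.

(** * Sequential compactness of Painleve-Kuratowski convergence in the product space *)

Lemma rV_rat_dense (R : realType) n (x : 'rV[R]_n) (e : R) : 0 < e ->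
  exists r : 'rV[rat]_n, `|x - map_mx ratr r| < e.
Proof.
move=> e0; have /choice[r hr] i : exists q, `|x ord0 i - ratr q| < e.
  have [|q] := @rat_in_itvoo R (x ord0 i - e) (x ord0 i + e); first by lra.
  rewrite in_itv/= => /andP[? ?]; exists q.
  by rewrite ltr_norml; apply/andP; split; lra.
exists (\row_i r i); rewrite [ltLHS]/Num.norm/= mx_normrE.
by apply/bigmax_ltP; split=> // -[i j] _ /=; rewrite (ord1 i) !mxE.
Qed.

(** Balls with rational centres and radii [1 / (N + 1)] supply the countable base. *)
Lemma rV2_PK_sequentially_compact (R : realType) n m
    (C : nat -> set ('rV[R]_n * 'rV[R]_m)) :
  exists (phi : nat -> nat) (D : set ('rV[R]_n * 'rV[R]_m)),
    (forall i j, (i < j)%N -> (phi i < phi j)%N) /\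
    PK_converges (C \o phi) D.
Proof.
pose ctr (r : 'rV[rat]_n * 'rV[rat]_m) : 'rV[R]_n * 'rV[R]_m :=
  (map_mx ratr r.1, map_mx ratr r.2).
apply: (@PK_sequentially_compact R _ (('rV[rat]_n * 'rV[rat]_m) * nat)%type
  (fun i => ball (ctr i.1) i.2.+1%:R^-1)); last first.
  by move=> i; apply: ball_open; rewrite invr_gt0 ltr0n.
move=> w e e0; have [N /(_ N (leqnn _)) hN] := @natSinv_lt R (e / 2) ltac:(lra).
have N0 : 0 < N.+1%:R^-1 :> R by rewrite invr_gt0 ltr0n.
have [r1 h1] := rV_rat_dense w.1 N0; have [r2 h2] := rV_rat_dense w.2 N0.
have rw : `|w - ctr (r1, r2)| < N.+1%:R^-1 by rewrite prod_normE/= gt_max h1 h2.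
exists ((r1, r2), N); split; first by rewrite -ball_normE/= distrC.
move=> z; rewrite -ball_normE/= => zr.
rewrite -(subrKA (ctr (r1, r2))) (le_lt_trans (ler_normD _ _))//.
by rewrite (distrC z) (distrC _ w) [ltRHS]splitr ltrD// (lt_trans _ hN).
Qed.

(** * Convexity, and compactness of sums and multiples of sets *)

Section ConvexSets.
Context {R : realType} {E : normedModType R}.

Lemma convex_setP (A : set E) : @convex_set R E A <->
  forall x y (k : R), 0 <= k <= 1 -> A x -> A y -> A (k *: x + (1 - k) *: y).
Proof.
split=> [cA x y k /andP[k0 k1] Ax Ay|cA x y k].
  by have /set_mem := cA x y (Itv01 k0 k1) (mem_set Ax) (mem_set Ay).
move=> /set_mem Ax /set_mem Ay; apply/mem_set.
by apply: (cA x y k%:num) => //; apply/andP; split.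
Qed.

Lemma compact_setadd (A B : set E) :
  compact A -> compact B -> compact (setadd A B).
Proof.
move=> cA cB.
rewrite (_ : setadd A B = (fun z : E * E => z.1 + z.2) @` (A `*` B)).
  apply: continuous_compact; last exact: compact_setX.
  by apply: continuous_subspaceT => z; exact: add_continuous.
apply/seteqP; split=> [_ [a [b [Aa Bb ->]]]|_ [[a b] [/= Aa Bb] <-]].
  by exists (a, b).
by exists a, b.
Qed.

Lemma compact_setscale k (A : set E) : compact A -> compact (setscale k A).
Proof.
move=> cA; apply: continuous_compact => //.
by apply: continuous_subspaceT => z; exact: scaler_continuous.
Qed.

End ConvexSets.

(** * Normals to the tangent cone, and the moving front *)

Section EuclideanProduct.
Context {R : realType} {n m : nat}.
Local Notation E := ('rV[R]_n * 'rV[R]_m)%type.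
Implicit Types (z w v c : E) (A : set E).

Definition dotp z w : R := dotv z.1 w.1 + dotv z.2 w.2.

Lemma continuous_dotp (T : topologicalType) (f g : T -> E) :
  continuous f -> continuous g -> continuous (fun t => dotp (f t) (g t)).
Proof.
move=> fc gc.
have fstc (h : T -> E) : continuous h -> continuous (fun t => (h t).1).
  by move=> hc t; apply: (cvg_comp h fst (hc t)); exact: cvg_fst.
have sndc (h : T -> E) : continuous h -> continuous (fun t => (h t).2).
  by move=> hc t; apply: (cvg_comp h snd (hc t)); exact: cvg_snd.
move=> t; exact: (cvgD (continuous_dotv (fstc _ fc) (fstc _ gc) (x := t))
  (continuous_dotv (sndc _ fc) (sndc _ gc) (x := t))).
Qed.

Lemma continuous_dotpr w : continuous (fun v => dotp w v).
Proof. by apply: continuous_dotp => v; [exact: cvg_cst | exact: cvg_id]. Qed.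

Lemma dotp0l z : dotp 0 z = 0.
Proof. by rewrite /dotp/= !dotv0l addr0. Qed.

Lemma dotp_le0_eq0 z : dotp z z <= 0 -> z = 0.
Proof.
case: z => a b; rewrite /dotp/= => h.
have [a0 b0] : dotv a a = 0 /\ dotv b b = 0.
  by have := dotv_ge0 a; have := dotv_ge0 b; split; lra.
by congr (_, _); apply: enorm_eq0; rewrite enormE ?a0 ?b0 sqrtr0.
Qed.

(** With [z i = c + t i V i], expanding [|w - z i|^2] and dividing the minimality inequality by
    [t i] leaves [2 <w - c, V i> <= <z i - c, V i>], whose right side tends to [0]. *)
Lemma dotp_normal_tangent_cone A w c v (r : R) : 0 < r ->
  (forall z, A z -> `|z - c| < r ->
    dotp (w - c) (w - c) <= dotp (w - z) (w - z)) ->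
  tangent_cone A c v -> dotp (w - c) v <= 0.
Proof.
move=> r0 wmin [z [t [Az zc [t0 _] tv]]].
pose V i := (t i)^-1 *: (z i - c).
have lim1 : (fun i => 2 * dotp (w - c) (V i)) @ \oo --> 2 * dotp (w - c) v.
  exact: (cvgM (cvg_cst _) (cvg_comp _ _ tv (@continuous_dotpr (w - c) v))).
have lim2 : (fun i => dotp (z i - c) (V i)) @ \oo --> dotp (0 : E) v.
  have zc0 : (fun i => z i - c) @ \oo --> (0 : E).
    by rewrite -(subrr c); apply: cvgB => //; exact: cvg_cst.
  have dotpc : continuous (fun zz : E * E => dotp zz.1 zz.2).
    by apply: continuous_dotp => zz; [exact: cvg_fst | exact: cvg_snd].
  exact: (cvg_comp _ _ (cvg_pair zc0 tv) (dotpc (0, v))).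
suff : 2 * dotp (w - c) v <= dotp (0 : E) v.
  by rewrite dotp0l; lra.
apply: (ler_cvg_to lim1 lim2).
move: zc => /cvg_seqP /(_ _ r0) [N hN]; exists N => // i /hN/(wmin _ (Az i)).
have -> : w - z i = (w - c) - t i *: V i.
  by rewrite scalerA divff ?gt_eqF// scale1r opprB addrA subrK.
have -> : z i - c = t i *: V i by rewrite scalerA divff ?gt_eqF// scale1r.
move: (t i) (t0 i) (V i) (w - c) => s s0 [v1 v2] [w1 w2].
rewrite /dotp/= !dotvE (dotvC v1 w1) (dotvC v2 w2) => h.
by rewrite -(ler_pM2l s0); lra.
Qed.

(** A half-space through the origin is closed and convex, so passing to the closed convex hull loses
    no polar vector. *)
Lemma dotp_le0_clco A w :
  A `<=` [set v | dotp w v <= 0] -> clco A `<=` [set v | dotp w v <= 0].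
Proof.
move=> Aw; rewrite /clco (closure_id [set v | dotp w v <= 0]).1; last first.
  rewrite (_ : mkset _ = (fun v => dotp w v) @^-1` [set r | r <= 0])//.
  apply: closed_comp => [x _|]; last exact: closed_le.
  exact: continuous_dotpr.
apply: closure_subset; apply: smallest_sub => //; apply/convex_setP.
move=> [x1 x2] [y1 y2] k /andP[k0 k1]; rewrite /dotp/= !dotvE => hx hy.
have : k * (dotv w.1 x1 + dotv w.2 x2) <= 0 by rewrite mulr_ge0_le0.
have : (1 - k) * (dotv w.1 y1 + dotv w.2 y2) <= 0.
  by rewrite mulr_ge0_le0// subr_ge0.
by lra.
Qed.

(* The squared distance [f t] between [A] and the front
   [{x + t u} x (y - t D)] satisfies [f (t + h) <= f t + h^2 * B], because the
   residual at a minimiser makes an obtuse angle with an admissible velocity;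
   subdividing [[0, T]] then forces [f T = 0]. *)
Lemma front_reaches (x u : 'rV[R]_n) (y : 'rV[R]_m) (D : set 'rV[R]_m) A
    (T : R) (F := fun t (eta : 'rV[R]_m) => (x + t *: u, y - t *: eta) : E) :
  compact A -> A (x, y) -> compact D -> @convex_set R 'rV[R]_m D -> D !=set0 ->
  0 <= T ->
  (forall t c eta, 0 <= t <= T -> A c -> D eta ->
    (forall c' eta', A c' -> D eta' ->
      dotp (F t eta - c) (F t eta - c) <=
        dotp (F t eta' - c') (F t eta' - c')) ->
    exists2 eta', D eta' & dotp (F t eta - c) (u, - eta') <= 0) ->
  exists2 eta, D eta & A (F T eta).
Proof.
move=> cA Axy cD /convex_setP convD [eta0 Deta0] T0 descent.
pose f t c (eta : 'rV[R]_m) := dotp (F t eta - c) (F t eta - c).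
have minf t : exists c eta, [/\ A c, D eta &
    forall c' eta', A c' -> D eta' -> f t c eta <= f t c' eta'].
  have [|||[c eta]] := @compact_EVT_min _ R
    (fun p : E * 'rV[R]_m => f t p.1 p.2) (A `*` D).
  - by exists ((x, y), eta0).
  - exact: compact_setX.
  - apply: continuous_subspaceT.
    have h1 : continuous (fun p : E * 'rV[R]_m => y - t *: p.2).
      move=> p; apply: cvgB; first exact: cvg_cst.
      by apply: cvgZr; exact: cvg_snd.
    have h2 : continuous (fun p : E * 'rV[R]_m => F t p.2).
      by move=> p; exact: (cvg_pair (cvg_cst (x + t *: u)) (h1 p)).
    have h3 : continuous (fun p : E * 'rV[R]_m => F t p.2 - p.1).
      by move=> p; apply: (cvgB (h2 p)); exact: cvg_fst.
    exact: continuous_dotp.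
  - rewrite inE => -[/= Ac Deta] h; exists c, eta; split=> // c' eta' Ac' Deta'.
    by apply: (h (c', eta')); rewrite inE.
have [B hB] : exists B : R, forall eta, D eta ->
    dotp (u, - eta) (u, - eta) <= B.
  have [|||eta _ h] := @compact_EVT_max _ R
    (fun eta : 'rV[R]_m => dotp (u, - eta) (u, - eta)) D.
  - by exists eta0.
  - exact: cD.
  - apply: continuous_subspaceT.
    suff h : continuous (fun eta : 'rV[R]_m => (u, - eta) : E).
      exact: continuous_dotp.
    by move=> p; exact: (cvg_pair (cvg_cst u) (cvgN cvg_id)).
  - by eexists => eta' Deta'; apply: h; exact: mem_set.
have steps N k : (k <= N.+1)%N -> exists c eta, [/\ A c, D eta &
    f (k%:R * (T / N.+1%:R)) c eta <= k%:R * ((T / N.+1%:R) ^+ 2 * B)].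
  elim: k => [_|k ih kN].
    exists (x, y), eta0; split=> //.
    by rewrite !mul0r /f /F !scale0r addr0 subr0 subrr dotp0l.
  have {ih} [c' [eta' [Ac' Deta' le_f]]] := ih (ltnW kN).
  set h := T / N.+1%:R in le_f *; set t := k%:R * h.
  have h0 : 0 <= h by rewrite divr_ge0.
  have t0 : 0 <= t by rewrite mulr_ge0.
  have tT : t <= T.
    rewrite /t /h mulrCA ler_piMr// ler_pdivrMr ?ltr0n// mul1r ler_nat.
    exact: ltnW.
  have [c [eta [Ac Deta fmin]]] := minf t.
  have [|eta1 Deta1 angle] := descent t c eta _ Ac Deta fmin; first exact/andP.
  (* The weight [t / (t + h)] used below needs [t + h] nonzero; otherwise [t = h = 0] and the front
     has not moved. *)
  have [th0|th0] := eqVneq (t + h) 0.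
    have /andP[/eqP tz /eqP hz] : (t == 0) && (h == 0) by lra.
    exists c', eta'; split=> //; move: le_f; rewrite hz !mulr0.
    by rewrite expr0n/= mul0r !mulr0.
  have {}th0 : 0 < t + h by rewrite lt_neqAle eq_sym th0 addr_ge0.
  (* Multiplied by [t + h] this convex combination is [t eta + h eta1], so the front point moves
     from [F t eta] by exactly [h (u, - eta1)]. *)
  exists c, ((t / (t + h)) *: eta + (1 - t / (t + h)) *: eta1); split=> //.
    apply: convD => //; rewrite divr_ge0 ?(ltW th0)//=.
    by rewrite ler_pdivrMr// mul1r lerDl.
  have -> : k.+1%:R * h = t + h by rewrite -natr1 mulrDl mul1r.
  rewrite /f.
  have -> : F (t + h) ((t / (t + h)) *: eta + (1 - t / (t + h)) *: eta1) - c =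
      (F t eta - c) + h *: (u, - eta1).
    rewrite /F; congr (_, _) => /=.
      by rewrite scalerDl addrA; exact: addrAC.
    rewrite scalerDr !scalerA mulrBr mulr1 mulrCA divff ?gt_eqF// mulr1.
    rewrite (addrC t h) addrK opprD addrA scalerN; exact: addrAC.
  have := le_trans (fmin _ _ Ac' Deta') le_f.
  have := hB _ Deta1; move: angle; rewrite /f.
  move: (F t eta - c) => [w1 w2]; rewrite /dotp/= !dotvE.
  rewrite !(dotvC u) !(dotvC eta1) => angle bnd low.
  rewrite -natr1 mulrDl mul1r.
  have : h * (dotv w1 u - dotv w2 eta1) <= 0 by rewrite mulr_ge0_le0.
  have : h ^+ 2 * (dotv u u + dotv eta1 eta1) <= h ^+ 2 * B.
    by rewrite ler_wpM2l ?sqr_ge0//; lra.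
  lra.
have [c [eta [Ac Deta fmin]]] := minf T.
exists eta => //; suff /dotp_le0_eq0/subr0_eq -> : f T c eta <= 0 by [].
rewrite leNgt; apply/negP => f0.
(* The errors of [N + 1] steps of length [T / (N + 1)] add up to [T^2 B / (N + 1)], which drops
   below any positive number. *)
have fN N : f T c eta <= N.+1%:R^-1 * (T ^+ 2 * B).
  have [c' [eta' [Ac' Deta']]] := steps N N.+1 (leqnn _).
  have -> : N.+1%:R * (T / N.+1%:R) = T.
    by rewrite mulrCA divff ?mulr1// pnatr_eq0.
  have -> : N.+1%:R * ((T / N.+1%:R) ^+ 2 * B) = N.+1%:R^-1 * (T ^+ 2 * B).
    by field; rewrite addrC natr1 pnatr_eq0.
  by apply: le_trans; exact: fmin.
have TB0 : 0 < T ^+ 2 * B.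
  by have := lt_le_trans f0 (fN 0%N); rewrite invr1 mul1r.
have [N /(_ N (leqnn _))] := natSinv_lt (divr_gt0 f0 TB0).
by rewrite ltr_pdivlMr// ltNge fN.
Qed.

End EuclideanProduct.

(** * Normalised vectors and Euclidean neighbourhoods *)

Section UnitVectors.
Context {R : realType} {n : nat}.
Implicit Type b : 'rV[R]_n.

(* For [b = 0] this is [0], as [0^-1 = 0]. *)
Definition unitv b : 'rV[R]_n := (enorm b)^-1 *: b.

Lemma enorm_unitv b : b <> 0 -> enorm (unitv b) = 1.
Proof.
move=> /enorm_gt0 b0; rewrite enormZ ger0_norm ?invr_ge0 ?enorm_ge0//.
by rewrite mulVf// gt_eqF.
Qed.

Lemma enorm_unitv_le1 b : enorm (unitv b) <= 1.
Proof.
have [->|/eqP b0] := eqVneq b 0; last by rewrite enorm_unitv.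
by rewrite /unitv scaler0 enorm0.
Qed.

Lemma enorm_scale_unitv b : enorm b *: unitv b = b.
Proof.
have [->|/eqP/enorm_gt0 b0] := eqVneq b 0; first by rewrite enorm0 scale0r.
by rewrite scalerA divff ?scale1r// gt_eqF.
Qed.

Lemma dotv_unitv b : dotv b (unitv b) = enorm b.
Proof.
have [->|/eqP/enorm_gt0 b0] := eqVneq b 0; first by rewrite dotv0l enorm0.
by rewrite dotvZr -enorm_sqr expr2 mulKf// gt_eqF.
Qed.

Lemma nbhs_enorm b (s : R) : 0 < s -> nbhs b [set y | enorm (y - b) < s].
Proof.
(* The [+ 1] keeps the denominator positive when [n = 0]. *)
move=> s0; have c0 : 0 < Num.sqrt n%:R + 1 :> R.
  by rewrite ltr_wpDl// sqrtr_ge0.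
apply/nbhs_ballP; exists (s / (Num.sqrt n%:R + 1)); first exact: divr_gt0.
move=> y; rewrite -ball_normE/= distrC ltr_pdivlMr// => h.
apply: le_lt_trans h; apply: (le_trans (enorm_le_normr _)).
by rewrite mulrC ler_wpM2l// lerDl.
Qed.

End UnitVectors.

(** * The enlarged prefan [H + delta] *)

Section SvmapPlus.
Context {R : realType} {n m : nat}.
Variable H : svmap R n m.
Implicit Types (d t : R) (w : 'rV[R]_n) (e : 'rV[R]_m).

Lemma svmap_plusP d w e : 0 <= d -> svmap_plus H d w e <->
  exists k b, [/\ H w k, enorm b <= d * enorm w & e = k + b].
Proof.
move=> d0; split=> [[k [_ [Hk [b /= b1 <-] ->]]]|[k [b [Hk bd ->]]]].
  exists k; eexists; split; [by []| |by []].
  rewrite enormZ ger0_norm ?mulr_ge0 ?enorm_ge0//.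
  by rewrite ler_piMr// mulr_ge0 ?enorm_ge0.
exists k, b; split=> //.
(* A zero radius forces [b = 0] and cannot be divided by, so the unit ball point is then taken to be
   [0]. *)
have [dw0|dw0] := eqVneq (d * enorm w) 0.
  exists 0; first by rewrite /= /eunit_ball/= enorm0.
  rewrite scaler0; apply/esym/enorm_eq0/eqP.
  by rewrite eq_le enorm_ge0 andbT -dw0.
exists ((d * enorm w)^-1 *: b); last by rewrite scalerA divff// scale1r.
have dw : 0 < d * enorm w by rewrite lt_neqAle eq_sym dw0 mulr_ge0 ?enorm_ge0.
by rewrite /eunit_ball/= enormZ gtr0_norm ?invr_gt0// mulrC ler_pdivrMr// mul1r.
Qed.

Hypothesis prefanH : prefan H.

Lemma svmap_plus_scale d t w e : 0 <= d -> 0 < t ->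
  svmap_plus H d w e -> svmap_plus H d (t *: w) (t *: e).
Proof.
move=> d0 t0 /(svmap_plusP _ _ d0)[k [b [Hk bw ->]]].
apply/(svmap_plusP _ _ d0); exists (t *: k), (t *: b); split.
- by have [[_ ->//] _ _] := prefanH; exists k.
- by rewrite !enormZ gtr0_norm// mulrCA ler_pM2l.
- exact: scalerDr.
Qed.

Lemma svmap_plus_compact d w : compact (svmap_plus H d w).
Proof.
have [_ /(_ w)[_ _ cH] _] := prefanH.
apply: compact_setadd => //; apply: compact_setscale; exact: compact_enorm_le.
Qed.

Lemma svmap_plus_convex d w : 0 <= d ->
  @convex_set R 'rV[R]_m (svmap_plus H d w).
Proof.
move=> d0; have [_ /(_ w)[_ /convex_setP cH _] _] := prefanH.
apply/convex_setP => _ _ k k01 /(svmap_plusP _ _ d0)[k1 [b1 [Hk1 bd1 ->]]]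
  /(svmap_plusP _ _ d0)[k2 [b2 [Hk2 bd2 ->]]].
apply/(svmap_plusP _ _ d0).
exists (k *: k1 + (1 - k) *: k2), (k *: b1 + (1 - k) *: b2); split.
- exact: cH.
- move: k01 => /andP[k0 k1']; rewrite (le_trans (enormD _ _))// !enormZ.
  rewrite !ger0_norm ?subr_ge0//.
  have := ler_wpM2l k0 bd1.
  have : 0 <= 1 - k by rewrite subr_ge0.
  by move=> /ler_wpM2l /(_ _ _ bd2); lra.
- by rewrite !scalerDr addrACA.
Qed.

Lemma svmap_plus_nonempty d w : 0 <= d -> svmap_plus H d w !=set0.
Proof.
move=> d0; have [_ /(_ w)[[k Hk] _ _] _] := prefanH.
exists (k + 0); apply/(svmap_plusP _ _ d0); exists k, 0; split=> //.
by rewrite enorm0 mulr_ge0 ?enorm_ge0.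
Qed.

Lemma prefan_bounded : exists2 M : R, 0 <= M &
  forall w e, enorm w <= 1 -> H w e -> enorm e <= M.
Proof.
have [[H00 _] _ finH] := prefanH.
have bnd w e : enorm w <= 1 -> H w e -> enorm e <= fine (outer_norm H).
  move=> w1 He; rewrite -lee_fin fineK//.
  apply: (@le_trans _ _ (ereal_sup [set (enorm z)%:E | z in H w])).
    by apply: ereal_sup_ubound; exists e.
  by apply: ereal_sup_ubound; exists w.
exists (fine (outer_norm H)) => //.
by apply: le_trans (bnd 0 0 _ H00); rewrite ?enorm_ge0 ?enorm0.
Qed.

End SvmapPlus.

(** * Necessity: tangent vectors with second component in [- (H + delta)(- p)] *)

Section Necessity.
Context {R : realType} {n m : nat}.
Variables (S H : svmap R n m) (xbar : 'rV[R]_n) (ybar : 'rV[R]_m).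
Hypothesis prefanH : prefan H.
Hypothesis psd : pseudo_strictly_differentiable S H xbar ybar.

Lemma psd_tangent_cone (d : R) p : 0 < d -> exists2 r : R, 0 < r &
  forall z, gph S z -> `|z - (xbar, ybar)| < r ->
    exists2 e, svmap_plus H d (- p) e & tangent_cone (gph S) z (p, - e).
Proof.
move=> d0.
have [U [V [/nbhs_ballP[rU rU0 hU] /nbhs_ballP[rV rV0 hV] hS]]] :=
  psd d0.
exists (Num.min rU rV); first by rewrite lt_min rU0 rV0.
move=> [x y] /= Sxy; rewrite prod_normE/= gt_max !lt_min.
move=> /andP[/andP[xU _] /andP[_ yV]].
(* Steps shorter than [t0] keep [x + t p] in [U]; the [1 +] covers [p = 0]. *)
pose t0 := (rU - `|x - xbar|) / (1 + `|p|).
have p1 : 0 < 1 + `|p| by rewrite ltr_pwDl.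
have t00 : 0 < t0 by rewrite divr_gt0// subr_gt0.
have inU t : 0 <= t -> t < t0 -> U (x + t *: p).
  move=> tge; rewrite ltr_pdivlMr// => tt0.
  apply: hU; rewrite -ball_normE/= distrC addrAC.
  rewrite (le_lt_trans (ler_normD _ _))//.
  rewrite normrZ ger0_norm// -ltrBrDl (le_lt_trans _ tt0)//.
  by rewrite ler_wpM2l// lerDr.
pose t (i : nat) := Num.min (t0 / 2) i.+1%:R^-1.
have tgt i : 0 < t i by rewrite lt_min divr_gt0//= invr_gt0 ltr0n.
have tlt i : t i < t0 by rewrite gt_min; apply/orP; left; lra.
have /choice[e he] i : exists e, svmap_plus H d (- p) e /\
    S (x + t i *: p) (y - t i *: e).
  have Vy : V y by apply: hV; rewrite -ball_normE/= distrC.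
  have Ux : U x by apply: hU; rewrite -ball_normE/= distrC.
  (* Moving from [x] to [x + t i p] gives a value of [H + d] at [- t i p]; homogeneity rescales it
     to [- p]. *)
  have [y' [e' [Sy' He' /= yE]]] :=
    hS x _ Ux (inU _ (ltW (tgt i)) (tlt i)) _ (conj Sxy Vy).
  exists ((t i)^-1 *: e'); split.
    have := svmap_plus_scale prefanH (ltW d0) _ He' (t := (t i)^-1).
    rewrite invr_gt0 opprD addNKr -scalerN scalerA mulVf ?gt_eqF// scale1r.
    exact.
  by rewrite scalerA divff ?gt_eqF// scale1r yE addrK.
have [es Hes fes] := compact_frequently
  (@svmap_plus_compact _ _ _ _ prefanH d (- p)) (fun i => (he i).1).
exists es => //; apply: tangent_coneP => eps eps0.
(* [Q] dominates both [1] and the norm of [(p, - e i)], so [t i * Q < eps] controls the step size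
   and the displacement together. *)
pose Q := `|p| + `|es| + 1 + 1.
have Q0 : 0 < Q by rewrite ltr_pwDr// ?addr_ge0.
have [K hK] := natSinv_lt (divr_gt0 eps0 Q0).
have [|i Ki] := fes (Num.min eps 1) K; first by rewrite lt_min eps0 ltr01.
rewrite lt_min => /andP[ie i1].
have tQ : t i * Q < eps.
  rewrite -ltr_pdivlMr// (le_lt_trans _ (hK i Ki))// ge_min; apply/orP; right.
  exact: lexx.
have ei : `|e i| <= `|es| + 1.
  by rewrite -(subrK es (e i)) addrC (le_trans (ler_normD _ _))// lerD2l ltW.
exists (x + t i *: p, y - t i *: e i), (t i).
have -> : (x + t i *: p, y - t i *: e i) - (x, y) = t i *: (p, - e i).
  by congr (_, _) => /=; rewrite addrC addKr// scalerN.
split.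
- exact: (he i).2.
- rewrite tgt /=; apply: le_lt_trans tQ; rewrite ler_peMr ?(ltW (tgt i))//.
  by rewrite lerDr ?addr_ge0.
- rewrite normrZ gtr0_norm// (le_lt_trans _ tQ)// ler_wpM2l ?(ltW (tgt i))//.
  rewrite prod_normE/= ge_max normrN /Q; apply/andP; split.
    by rewrite -!addrA lerDl !addr_ge0.
  rewrite (le_trans ei)//; have := normr_ge0 p; lra.
- rewrite scalerA mulVf ?gt_eqF// scale1r.
  rewrite (_ : _ - _ = (0, es - e i)); last first.
    by congr (_, _) => /=; rewrite ?subrr// opprK addrC.
  by rewrite prod_normE/= normr0 gt_max eps0 distrC.
Qed.

(** Taking [d = 1 / (i + 1)] gives vectors [(p, - (k + b))] with [k] in the compact set [H (- p)]
    and [b] vanishing as [i] grows. At a cluster point [k], the pair [(p, - k)] lies in the outer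
    limit. Any [F] containing the tangent cones is allowed, which covers their closed convex
    hulls. *)
Lemma psd_limsup (F : 'rV[R]_n * 'rV[R]_m -> set ('rV[R]_n * 'rV[R]_m))
    (G : svmap R n m) p :
  (forall z, tangent_cone (gph S) z `<=` F z) ->
  LIMSUP (gph S) (xbar, ybar) F (gph G) ->
  G p `&` setopp (H (- p)) !=set0.
Proof.
move=> TF [z [Sz zbar [_ outerG]]].
have /choice[f hf] (i : nat) : exists jkb : nat * 'rV[R]_m * 'rV[R]_m,
    [/\ (i <= jkb.1.1)%N, H (- p) jkb.1.2, enorm jkb.2 <= i.+1%:R^-1 * enorm p
      & F (z jkb.1.1) (p, - (jkb.1.2 + jkb.2))].
  have i0 : 0 < i.+1%:R^-1 :> R by rewrite invr_gt0 ltr0n.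
  have [r r0 hr] := psd_tangent_cone p i0.
  move: zbar => /cvg_seqP /(_ _ r0) [N hN].
  (* The index is at least [N] to be near the base point and at least [i] so that the indices are
     unbounded, as the outer limit requires. *)
  have [_ /(svmap_plusP _ _ _ (ltW i0))[k [b [Hk bp ->]]] Tz] :=
    hr _ (Sz (maxn i N)) (hN _ (leq_maxr _ _)).
  exists (maxn i N, k, b); split=> //=; first exact: leq_maxl.
    by move: bp; rewrite enormN.
  exact: TF.
have [_ /(_ (- p))[_ _ cH] _] := prefanH.
have [|k Hk fk] := @compact_frequently _ _ _ (fun i => (f i).1.2) cH.
  by move=> i; have [] := hf i.
exists (- k); split; last by exists k.
suff : gph G (p, - k) by [].
rewrite -outerG; apply/outer_limitP => e N e0.
have p0 : 0 < 1 + enorm p by rewrite ltr_pwDl ?enorm_ge0.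
have e2 : 0 < e / 2 by rewrite divr_gt0.
have [K hK] := natSinv_lt (divr_gt0 e2 p0).
have [i] := fk (e / 2) (maxn N K) e2; rewrite geq_max => /andP[Ni /hK Ki] ik.
have [ij _ bi Fi] := hf i.
exists (f i).1.1; first exact: leq_trans ij.
exists (p, - ((f i).1.2 + (f i).2)) => //.
rewrite (_ : _ - _ = (0, - ((f i).1.2 - k) - (f i).2)); last first.
  by congr (_, _) => /=; rewrite ?subrr// opprK opprD opprB addrAC [k - _]addrC.
rewrite prod_normE/= normr0 gt_max e0/=.
rewrite (le_lt_trans (ler_normD _ _))// !normrN [ltRHS]splitr ltrD//.
rewrite (le_lt_trans (normr_le_enorm _))// (le_lt_trans bi)//.
move: Ki; rewrite ltr_pdivlMr//; apply: le_lt_trans.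
by rewrite ler_wpM2l// lerDr.
Qed.

End Necessity.

(** * Sufficiency: uniform approximation, polar vectors and the front argument *)

Section Sufficiency.
Context {R : realType} {n m : nat}.
Local Notation E := ('rV[R]_n * 'rV[R]_m)%type.
Implicit Types (P A : set E) (F : E -> set E) (H : svmap R n m).

(** The condition that [P], read as a graph, meets [- H (- u)] above [u], relaxed to an error [d] in
    both components. *)
Definition approximates_directions H (d : R) P := forall u, enorm u = 1 ->
  exists p q k,
    [/\ P (p, q), H (- u) k, enorm (p - u) <= d & enorm (q + k) <= d].

(* Uniformity in [u]: the values [H (- u)] on the unit sphere are bounded, so
   along a bad sequence of directions the points of [gph G] above them
   accumulate, and one of them is close to infinitely many others. *)
Lemma limsup_approximates_directions H A (zbar : E) F : prefan H ->
  (forall (G : svmap R n m) p, p <> 0 -> LIMSUP A zbar F (gph G) ->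
     G p `&` setopp (H (- p)) !=set0) ->
  forall d : R, 0 < d -> exists2 r : R, 0 < r &
    forall z, A z -> `|z - zbar| < r -> approximates_directions H d (F z).
Proof.
move=> prefanH cond d d0; apply: contrapT => noR.
have /choice[zu hzu] (i : nat) : exists zu : E * 'rV[R]_n,
    [/\ A zu.1, `|zu.1 - zbar| < i.+1%:R^-1, enorm zu.2 = 1 &
     forall p q k, F zu.1 (p, q) -> H (- zu.2) k ->
       enorm (p - zu.2) <= d -> enorm (q + k) <= d -> False].
  apply: contrapT => bad; apply: noR; exists i.+1%:R^-1.
    by rewrite invr_gt0 ltr0n.
  move=> z Az zr u u1; apply: contrapT => nou; apply: bad; exists (z, u).
  by split=> //= p q k ? ? ? ?; apply: nou; exists p, q, k.
have [phi [D [inc PKD]]] := rV2_PK_sequentially_compact (fun j => F (zu j).1).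
pose G : svmap R n m := fun p q => D (p, q).
have gphG : gph G = D by apply/seteqP; split=> -[].
have limG : LIMSUP A zbar F (gph G).
  exists (fun j => (zu (phi j)).1); split.
  - by move=> j; have [] := hzu (phi j).
  - apply: cvg_natSinv => i; have [_ h _ _] := hzu (phi i).
    apply: (lt_le_trans h); rewrite lef_pV2 ?posrE ?ltr0n// ler_nat ltnS.
    exact: increasing_ge.
  - by rewrite gphG.
pose u j := (zu (phi j)).2.
have u1 j : enorm (u j) = 1 by have [] := hzu (phi j).
have /choice[k hk] j : exists k, H (- u j) k /\ D (u j, - k).
  have [|q [Gq [k Hk kq]]] := cond G (u j) _ limG; last first.
    by exists k; rewrite kq.
  by move=> u0; have := u1 j; rewrite u0 enorm0 => /esym/eqP; rewrite oner_eq0.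
have [M M0 hM] := prefan_bounded prefanH.
have [|w _ fw] := @compact_frequently _ _ _ (fun j => (u j, - k j) : E)
    (compact_setX (@compact_enorm_le R n 1) (@compact_enorm_le R m M)).
  move=> j; split=> /=; first by rewrite u1.
  by rewrite enormN (hM (- u j))// ?enormN ?u1//; have [] := hk j.
(* [c] converts sup norms into Euclidean norms in both factors, and the [3] in [e] pays for three
   triangle inequalities. *)
pose c : R := Num.sqrt n%:R + Num.sqrt m%:R + 1.
have sn : 0 <= Num.sqrt n%:R :> R by rewrite sqrtr_ge0.
have sm : 0 <= Num.sqrt m%:R :> R by rewrite sqrtr_ge0.
have c0 : 0 < c by rewrite /c; lra.
pose e := d / (3 * c).
have e0 : 0 < e by rewrite divr_gt0// mulr_gt0.
(* The order matters: the inner limit approximates only a fixed point, so [N0] is frozen first, then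
   [K] is obtained for it, and then a return [N >= K] near [w]. *)
have [N0 _ close0] := fw e 0%N e0.
have [K hK] : exists N, forall j, (N <= j)%N ->
    exists2 z, F (zu (phi j)).1 z & `|z - (u N0, - k N0)| < e.
  have : inner_limit ((fun j => F (zu j).1) \o phi) (u N0, - k N0).
    by rewrite PKD.1; have [] := hk N0.
  by move=> /inner_limitP/(_ _ e0).
have [N KN closeN] := fw e K e0.
have [z Fz zN0] := hK N KN.
have zN : `|z - (u N, - k N)| <= 3 * e.
  have -> : z - (u N, - k N) = (z - (u N0, - k N0)) + ((u N0, - k N0) - w)
      - ((u N, - k N) - w).
    by rewrite opprB !subrKA.
  rewrite (le_trans (ler_normB _ _))//.
  rewrite (le_trans (lerD (ler_normD _ _) (lexx _)))//.
  lra.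
have [_ _ _ bad] := hzu (phi N).
have ed : 3 * e * c = d by rewrite /e; field; rewrite gt_eqF.
have small l (v : 'rV[R]_l) :
    Num.sqrt l%:R <= c -> `|v| <= 3 * e -> enorm v <= d.
  move=> lc ve; rewrite (le_trans (enorm_le_normr _))// -ed mulrC.
  by rewrite ler_pM// sqrtr_ge0.
move: zN; rewrite prod_normE ge_max => /andP[/= z1 z2].
apply: (bad z.1 z.2 (k N)).
- by rewrite -surjective_pairing.
- by have [] := hk N.
- by apply: small z1; rewrite /c; lra.
- by apply: small; [rewrite /c; lra | rewrite -[k N]opprK].
Qed.

(* Testing the polar vector [(a, b)] in the direction [a] bounds [a] by a
   multiple of [b], so the error in the direction [u] is absorbed by
   tilting along [b]. *)
Lemma polar_direction H P (d d1 M : R) (w : E) (u : 'rV[R]_n) :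
  (forall v k, enorm v <= 1 -> H v k -> enorm k <= M) ->
  0 <= M -> 0 < d1 -> d1 <= 1 / 2 -> d1 * (3 + 2 * M) <= d ->
  approximates_directions H d1 P -> P `<=` [set v | dotp w v <= 0] ->
  enorm u = 1 ->
  exists2 eta, svmap_plus H d (- u) eta & dotp w (u, - eta) <= 0.
Proof.
move=> hM M0 d10 d12 dd1 dirP; case: w => a b polar u1.
have test v k p q : enorm v = 1 -> H (- v) k -> enorm (p - v) <= d1 ->
    dotv a v + dotv b q <= dotv a p + dotv b q + enorm a * d1.
  move=> v1 Hk pv.
  have := dotv_le (- a) (p - v); rewrite enormN !dotvE.
  have := ler_wpM2l (enorm_ge0 a) pv.
  lra.
(* Testing along [a / |a|] gives [|a| <= |b| (M + d1) + |a| d1]; since [d1 <= 1 / 2], the last term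
   is absorbed on the left. *)
have ab : enorm a <= 2 * (M + 1) * enorm b.
  have [->|/eqP a0] := eqVneq a 0.
    by rewrite enorm0 !mulr_ge0 ?enorm_ge0//; lra.
  have [p [q [k [/polar pq Hk pa qk]]]] := dirP _ (enorm_unitv a0).
  have := test _ _ _ q (enorm_unitv a0) Hk pa; rewrite dotv_unitv => h.
  move: pq; rewrite /dotp/= => pq.
  have kM : enorm k <= M by apply: hM Hk; rewrite enormN enorm_unitv.
  have := dotv_le (- b) (q + k); have := dotv_le b k.
  rewrite enormN !dotvE.
  have := ler_wpM2l (enorm_ge0 b) qk; have := ler_wpM2l (enorm_ge0 b) kM.
  have := enorm_ge0 a; have := enorm_ge0 b.
  nra.
have [p [q [k [/polar pq Hk pu qk]]]] := dirP _ u1.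
have := test _ _ _ q u1 Hk pu; move: pq; rewrite /dotp/= => pq h.
have s0 : 0 <= 2 * (M + 1) * d1 by rewrite !mulr_ge0//; lra.
have d0 : 0 <= d by apply: le_trans dd1; rewrite mulr_ge0 ?ltW//; lra.
(* By [ab], the directional error [|a| d1] is at most [s |b|]. The witness below is [- q + s v]: the
   tilt [s v] contributes [- s |b|] and cancels that error, at distance at most
   [d1 + s = d1 (3 + 2 M) <= d] from [k]. *)
pose s := 2 * (M + 1) * d1.
have [v bv v1] : exists2 v, dotv b v = enorm b & enorm v <= 1.
  by exists (unitv b); [exact: dotv_unitv | exact: enorm_unitv_le1].
exists (k + (- (q + k) + s *: v)).
  apply/(svmap_plusP _ _ _ d0); exists k, (- (q + k) + s *: v); split=> //.
  rewrite enormN u1 mulr1 (le_trans (enormD _ _))// enormN enormZ ger0_norm//.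
  have := ler_wpM2l s0 v1; rewrite /s; lra.
rewrite !dotvE bv /s.
have := ler_wpM2r (ltW d10) ab; lra.
Qed.

Lemma normr_le_dotp (z : E) (L : R) : 0 <= L -> dotp z z <= L ^+ 2 -> `|z| <= L.
Proof.
move=> L0; rewrite /dotp -!enorm_sqr => h; rewrite prod_normE ge_max.
apply/andP; split; rewrite (le_trans (normr_le_enorm _))//;
    rewrite -ler_sqr ?nnegrE ?enorm_ge0//.
  by have := sqr_ge0 (enorm z.2); lra.
by have := sqr_ge0 (enorm z.1); lra.
Qed.

Lemma eball2_compact (C : set E) (zbar : E) (e : R) :
  closed (C `&` eball2 zbar e) -> compact (C `&` eball2 zbar e).
Proof.
move=> clC; apply: (subclosed_compact clC (compact_setX
  (@compact_enorm_le R n (e + enorm zbar.1))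
  (@compact_enorm_le R m (e + enorm zbar.2)))).
move=> z [_]; rewrite /eball2/= /enorm2/= => h.
have sq0 (x : R) : 0 <= x ^+ 2 by rewrite sqr_ge0.
split=> /=.
  rewrite -[X in enorm X](subrK zbar.1) (le_trans (enormD _ _))// lerD2r.
  apply: le_trans h; rewrite -[leLHS]ger0_norm ?enorm_ge0// -sqrtr_sqr.
  by rewrite ler_sqrt ?addr_ge0// lerDl.
rewrite -[X in enorm X](subrK zbar.2) (le_trans (enormD _ _))// lerD2r.
apply: le_trans h; rewrite -[leLHS]ger0_norm ?enorm_ge0// -sqrtr_sqr.
by rewrite ler_sqrt ?addr_ge0// lerDr.
Qed.

Lemma eball2_normr (zbar : E) (e : R) : 0 < e -> exists2 r : R, 0 < r &
  forall z, `|z - zbar| < r -> eball2 zbar e z.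
Proof.
move=> e0; pose c : R := Num.sqrt n%:R + Num.sqrt m%:R + 1.
have sn : 0 <= Num.sqrt n%:R :> R by rewrite sqrtr_ge0.
have sm : 0 <= Num.sqrt m%:R :> R by rewrite sqrtr_ge0.
have c0 : 0 < c by rewrite /c; lra.
exists (e / c) => [|z]; first exact: divr_gt0.
rewrite ltr_pdivlMr// => /ltW h; apply: le_trans h.
have [h1 h2] : `|(z - zbar).1| <= `|z - zbar| /\ `|(z - zbar).2| <= `|z - zbar|.
  by rewrite prod_normE !le_max !lexx orbT.
have l1 := le_trans (enorm_le_normr _) (ler_wpM2l sn h1).
have l2 := le_trans (enorm_le_normr _) (ler_wpM2l sm h2).
apply: (@le_trans _ _ (enorm (z - zbar).1 + enorm (z - zbar).2)); last first.
  by rewrite /c; have := normr_ge0 (z - zbar); lra.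
have g1 := enorm_ge0 (z - zbar).1; have g2 := enorm_ge0 (z - zbar).2.
rewrite /enorm2 -[leRHS]ger0_norm ?addr_ge0// -sqrtr_sqr ler_sqrt ?sqr_ge0//.
by rewrite sqrrD; have := mulr_ge0 g1 g2; lra.
Qed.

Lemma limsup_psd (S H : svmap R n m) F (xbar : 'rV[R]_n) (ybar : 'rV[R]_m) :
  locally_closed_at S (xbar, ybar) -> prefan H ->
  (forall z, F z `<=` clco (tangent_cone (gph S) z)) ->
  (forall (G : svmap R n m) p, p <> 0 ->
     LIMSUP (gph S) (xbar, ybar) F (gph G) ->
     G p `&` setopp (H (- p)) !=set0) ->
  pseudo_strictly_differentiable S H xbar ybar.
Proof.
move=> [eps eps0 clS] prefanH FT cond d d0.
have [M M0 hM] := prefan_bounded prefanH.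
pose d1 : R := Num.min (1 / 2) (d / (3 + 2 * M)).
have M3 : 0 < 3 + 2 * M by lra.
have d10 : 0 < d1 by rewrite lt_min divr_gt0//= divr_gt0.
have d12 : d1 <= 1 / 2 by rewrite ge_min lexx.
have dd1 : d1 * (3 + 2 * M) <= d by rewrite -ler_pdivlMr// ge_min lexx orbT.
have [r r0 hr] := limsup_approximates_directions prefanH cond d10.
have [rho rho0 hrho] := eball2_normr (xbar, ybar) eps0.
pose A := gph S `&` eball2 (xbar, ybar) eps.
have cA : compact A by exact: eball2_compact.
(* [L] bounds the speed of the front: [1 + |eta|^2 <= L^2]. *)
pose L : R := 1 + M + d.
have L0 : 0 < L by rewrite /L; lra.
(* Minimisers [c] will lie within [q] of the base point, so graph points within [q] of [c] stay
   within [2 q <= rho] and belong to [A]. *)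
pose q := Num.min r rho / 2.
have q0 : 0 < q by rewrite divr_gt0// lt_min r0 rho0.
have qr : 2 * q <= r by rewrite /q mulrC divfK// ge_min lexx.
have qrho : 2 * q <= rho by rewrite /q mulrC divfK// ge_min lexx orbT.
(* As [T <= 2 s], this gives [2 T L + s <= q]: one [T L] for the travel of the front, one for the
   residual at [c], and [s] for the offset of [(x, y)]. *)
pose s := q / (4 * L + 1).
have L4 : 0 < 4 * L + 1 by lra.
have s0 : 0 < s by rewrite divr_gt0.
have sq : s * (4 * L + 1) = q by rewrite /s divfK// gt_eqF.
exists [set x | enorm (x - xbar) < s], [set y | enorm (y - ybar) < s].
split; [exact: nbhs_enorm | exact: nbhs_enorm |].
move=> x x' /= xs x's y [Sxy ys].
have [<-|/eqP xx'] := eqVneq x x'.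
  exists y, 0; split=> //; last by rewrite addr0.
  rewrite subrr; apply/(svmap_plusP _ _ _ (ltW d0)); exists 0, 0.
  by rewrite !enorm0 mulr0 addr0; split=> //; have [[]] := prefanH.
pose T := enorm (x' - x); pose u := unitv (x' - x).
have x'x0 : x' - x <> 0 by move=> /subr0_eq /esym.
have T0 : 0 < T by exact: enorm_gt0.
have u1 : enorm u = 1 by exact: enorm_unitv.
have Tu : T *: u = x' - x by exact: enorm_scale_unitv.
clearbody u.
have Ts : T <= 2 * s.
  by have := enorm_triangle x' xbar x; rewrite (enormB xbar x) -/T; lra.
have near0 : `|(x, y) - (xbar, ybar)| <= s.
  by rewrite prod_normE ge_max/= !(le_trans (normr_le_enorm _)) ?ltW.
have LT : 2 * (T * L) + s <= q.
  by have := ler_wpM2r (ltW L0) Ts; rewrite -sq; lra.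
have TL0 : 0 <= T * L by rewrite mulr_ge0 ?ltW.
have Axy : A (x, y) by split=> //; apply: hrho; lra.
have [|eta Deta [Seta _]] := front_reaches (u := u) cA Axy
  (svmap_plus_compact prefanH (d := d) (w := - u))
  (svmap_plus_convex prefanH (ltW d0))
  (svmap_plus_nonempty prefanH (- u) (ltW d0)) (ltW T0); last first.
  exists (y - T *: eta), (T *: eta); split.
  - by move: Seta; rewrite /gph/= Tu addrC subrK.
  - have := svmap_plus_scale prefanH (ltW d0) T0 Deta.
    by rewrite scalerN Tu opprB.
  - by rewrite subrK.
move=> t c eta /andP[t0 tT] Ac Deta cmin.
pose w := (x + t *: u, y - t *: eta).
have wxy : w - (x, y) = t *: (u, - eta).
  by congr (_, _) => /=; rewrite addrC addKr// scalerN.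
have wL : dotp (w - (x, y)) (w - (x, y)) <= (T * L) ^+ 2.
  have etaM : enorm eta <= M + d.
    move: Deta => /(svmap_plusP _ _ _ (ltW d0))[k [b [Hk bd ->]]].
    rewrite (le_trans (enormD _ _))// lerD//.
      by apply: hM Hk; rewrite enormN u1.
    by move: bd; rewrite enormN u1 mulr1.
  rewrite wxy /dotp/= !dotvE -!enorm_sqr u1.
  have h1 : enorm eta ^+ 2 <= (M + d) ^+ 2.
    by rewrite ler_sqr// nnegrE ?enorm_ge0//; lra.
  have h2 : t ^+ 2 <= T ^+ 2 by rewrite ler_sqr// nnegrE ltW.
  have h3 : 1 + enorm eta ^+ 2 <= L ^+ 2 by rewrite /L; nra.
  have := ler_pM (sqr_ge0 t) _ h2 h3; rewrite addr_ge0 ?sqr_ge0// => /(_ isT).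
  by rewrite exprMn; lra.
(* The start [(x, y)] competes in the minimisation, so the residual is no longer than the distance
   travelled. *)
have cL : dotp (w - c) (w - c) <= (T * L) ^+ 2.
  exact: le_trans (cmin _ _ Axy Deta) wL.
have cq : `|c - (xbar, ybar)| <= q.
  have -> : c - (xbar, ybar) =
      ((w - (x, y)) - (w - c)) + ((x, y) - (xbar, ybar)).
    by rewrite opprB [w - (x, y) + _]addrC !subrKA.
  rewrite (le_trans (ler_normD _ _))//.
  rewrite (le_trans (lerD (ler_normB _ _) (lexx _)))//.
  have := normr_le_dotp TL0 wL; have := normr_le_dotp TL0 cL; lra.
(* The residual [w - c] is polar to [F c]: minimality over [A] is local minimality over the graph,
   hence polarity to the tangent cone, to its closed convex hull and to [F c]. *)
apply: (polar_direction hM M0 d10 d12 dd1 (hr c Ac.1 _)) => //; first lra.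
move=> v /FT; apply: dotp_le0_clco => {}v.
apply: (dotp_normal_tangent_cone q0) => z Sz zc; apply: cmin => //; split=> //.
apply: hrho; rewrite -(subrKA c) (le_lt_trans (ler_normD _ _))//; lra.
Qed.

End Sufficiency.

Theorem theorem3p8 (R : realType) (n m : nat) (S H : svmap R n m)
    (xbar : 'rV[R]_n) (ybar : 'rV[R]_m)
    (hxy : gph S (xbar, ybar))
    (hS : locally_closed_at S (xbar, ybar))
    (hH : prefan H) :
  (pseudo_strictly_differentiable S H xbar ybar <->
   forall (G : svmap R n m) (p : 'rV[R]_n), p <> 0 ->
     LIMSUP (gph S) (xbar, ybar) (fun z => tangent_cone (gph S) z) (gph G) ->
     G p `&` setopp (H (- p)) !=set0)
  /\
  (pseudo_strictly_differentiable S H xbar ybar <->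
   forall (G : svmap R n m) (p : 'rV[R]_n), p <> 0 ->
     LIMSUP (gph S) (xbar, ybar) (fun z => clco (tangent_cone (gph S) z))
       (gph G) ->
     G p `&` setopp (H (- p)) !=set0).
Proof.
(* Necessity asks that [F] contain the tangent cone, sufficiency that it lie in the closed convex
   hull; with this inclusion both choices of [F] meet both demands. *)
have Tclco (z : 'rV[R]_n * 'rV[R]_m) :
    tangent_cone (gph S) z `<=` clco (tangent_cone (gph S) z).
  by apply: subset_trans (@subset_closure _ _); exact: sub_smallest.
split; split.
- by move=> psd G p _; exact: (psd_limsup hH psd p (fun z => @subset_refl _ _)).
- exact: (limsup_psd hS hH Tclco).
- by move=> psd G p _; exact: (psd_limsup hH psd p Tclco).
- exact: (limsup_psd hS hH (fun z => @subset_refl _ _)).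
Qed.
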